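(* There is an infinite word over the alphabet $\{0,1\}$ that is rich and additive $5$-power-free.
   Context: A word over an alphabet $X$ (a nonempty finite set of letters; here $X\subseteq\mathbb{Z}$) is a finite or (one-sided) infinite sequence of letters from $X$. The length $|w|$ of a finite word $w$ is its number of letters, and its sum $\sum w$ is the sum (in $\mathbb{Z}$) of its letters, counted with multiplicity. The empty word $\varepsilon$ is the unique word of length $0$. A factor of a word $w$ is a finite word $y$ such that $w=xyz$ for some possibly empty words $x,z$ (contiguous subword). For an integer $k\ge 2$, an additive $k$-power is a word of the form $w_1w_2\cdots w_k$ where $w_1,\dots,w_k$ are nonempty finite words all having the same length and the same sum. A word is additive $k$-power-free if none of its factors is an additive $k$-power. A finite word is a palindrome if it equals its reversal (the empty word is a palindrome). A finite word of length $n$ is rich if it contains exactly $n+1$ distinct palindromes (including the empty word) as factors; an infinite word is rich if all of its finite factors are rich. *)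

(* Defs.v *)
From mathcomp Require Import all_boot all_order all_algebra.

Set Implicit Arguments.
Unset Strict Implicit.
Unset Printing Implicit Defensive.

Import GRing.Theory.

(* Finite words are sequences; the finite factors of a finite word [w] are the
   [y] with [infix y w].  One-sided infinite words are functions on [nat]. *)

Definition infinite_word (T : Type) := nat -> T.

Definition word_over (T : eqType) (X : seq T) (w : infinite_word T) : Prop :=
  forall i, w i \in X.

Definition factor_of (T : Type) (y : seq T) (w : infinite_word T) : Prop :=
  exists i, y = [seq w j | j <- iota i (size y)].

Definition palindrome (T : eqType) (w : seq T) : bool := rev w == w.

Definition factors (T : eqType) (w : seq T) : seq (seq T) :=
  undup [seq take l (drop i w) | i <- iota 0 (size w).+1,
                                 l <- iota 0 (size w).+1].

Lemma mem_factors (T : eqType) (w y : seq T) : (y \in factors w) = infix y w.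
Proof.
rewrite mem_undup; apply/allpairsP/infixP => [[[i l] /= [_ _ ->]]|[p [s ->]]].
  by exists (take i w), (drop l (drop i w)); rewrite !cat_take_drop.
exists (size p, size y).
split; last by rewrite drop_size_cat // take_size_cat.
  rewrite mem_iota add0n ltnS /=.
  by rewrite !size_cat leq_addr.
by rewrite mem_iota add0n ltnS /= !size_cat addnCA leq_addr.
Qed.

Lemma factors_uniq (T : eqType) (w : seq T) : uniq (factors w).
Proof. exact: undup_uniq. Qed.

Definition rich (T : eqType) (w : seq T) : Prop :=
  size [seq y <- factors w | palindrome y] = (size w).+1.

Definition infinite_rich (T : eqType) (w : infinite_word T) : Prop :=
  forall y, factor_of y w -> rich y.

Definition word_sum (w : seq int) : int := (\sum_(a <- w) a)%R.

Definition additive_power (k : nat) (w : seq int) : Prop :=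
  exists ws : seq (seq int),
    [/\ size ws = k,
        w = flatten ws,
        {in ws, forall u, u <> [::]} &
        {in ws &, forall u v, size u = size v /\ word_sum u = word_sum v}].

Definition additive_power_free (k : nat) (w : infinite_word int) : Prop :=
  forall y, factor_of y w -> ~ additive_power k y.

(* Main.v *)
Require Import Defs.
From mathcomp Require Import all_boot all_order all_algebra.
From mathcomp Require Import zify.

(* The word is the fixed point [t] of [0 -> 00001], [1 -> 01101], that is,
   [t (5 q + r)] is the [r]-th letter of [0 x x 0 1] with [x = t q].

   Additive 5-powers: the number of ones before position [5 q + r] is [q] plus
   twice that before [q], plus a term depending on [r] and [t q].  Comparing
   parities along the six boundaries of a 5-power of block length [n] forces
   [5 %| n] and, unless the boundaries descend to a 5-power of block length
   [n / 5], a strict alternation of the letters read at the boundaries divided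
   by 5, which a second parity comparison excludes.

   Richness: it suffices that whenever a palindrome occurs twice, the second
   occurrence is a suffix of a longer palindrome that starts no earlier than
   the first; then longest palindromic suffixes of factors occur only once.
   Palindromes of length at least 4 have determined residues modulo 5 and are
   centred on blocks, hence desubstitute; shorter ones recur as palindromic
   suffixes within distance 25, which is a finite check. *)

Set Implicit Arguments.
Unset Strict Implicit.
Unset Printing Implicit Defensive.

(** * Segments of infinite words *)

Definition seg (T : Type) (f : nat -> T) (i l : nat) : seq T :=
  [seq f j | j <- iota i l].

Lemma seg_comp (T U : Type) (g : T -> U) (f : nat -> T) i l :
  seg (g \o f) i l = map g (seg f i l).
Proof. by rewrite /seg -map_comp. Qed.

Lemma size_seg (T : Type) (f : nat -> T) i l : size (seg f i l) = l.
Proof. by rewrite size_map size_iota. Qed.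

Lemma nth_seg (T : Type) (x0 : T) (f : nat -> T) i l k :
  k < l -> nth x0 (seg f i l) k = f (i + k).
Proof. by move=> kl; rewrite (nth_map 0) ?size_iota // nth_iota. Qed.

Lemma seg_cat (T : Type) (f : nat -> T) i l1 l2 :
  seg f i (l1 + l2) = seg f i l1 ++ seg f (i + l1) l2.
Proof. by rewrite /seg iotaD map_cat. Qed.

Lemma eq_segP (T : Type) (f : nat -> T) i j l :
  seg f i l = seg f j l <-> (forall k, k < l -> f (i + k) = f (j + k)).
Proof.
split=> [e k kl|h].
  by rewrite -(nth_seg (f i) f i kl) e nth_seg.
apply: (@eq_from_nth _ (f i)); first by rewrite !size_seg.
by move=> k; rewrite size_seg => kl; rewrite !nth_seg // h.
Qed.

(** Mirror positions are paired by their sum, which turns later reflections into linear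
    arithmetic. *)
Lemma seg_palP (T : eqType) (f : nat -> T) i l :
  palindrome (seg f i l) <->
  (forall x y, i <= x -> i <= y -> (x + y).+1 = i + i + l -> f x = f y).
Proof.
split=> [/eqP e x y ix iy xy|h].
  have xl : x - i < l by lia.
  have := nth_seg (f i) f i xl; rewrite -e nth_rev ?size_seg // nth_seg; last lia.
  by rewrite (_ : i + (l - (x - i).+1) = y) 1?(_ : i + (x - i) = x) //; lia.
apply/eqP/(@eq_from_nth _ (f i)); rewrite size_rev //.
move=> k; rewrite size_seg => kl.
rewrite nth_rev ?size_seg // !nth_seg //; [apply: h; lia | lia].
Qed.

Lemma seg_factor (T : eqType) (f : nat -> T) i l (p : seq T) :
  infix p (seg f i l) ->
  exists2 j, i <= j & j + size p <= i + l /\ p = seg f j (size p).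
Proof.
case/infixP=> [u [v e]].
have el : l = size u + (size p + size v) by rewrite -(size_seg f i l) e !size_cat.
exists (i + size u); first exact: leq_addr.
split; first lia.
move: e; rewrite el !seg_cat => /eqP; rewrite eqseq_cat ?size_seg // => /andP[_].
by rewrite eqseq_cat ?size_seg // => /andP[/eqP].
Qed.

(** * Palindromic suffixes and richness *)

Lemma suffix_le_size (T : eqType) (w y z : seq T) :
  suffix y w -> suffix z w -> size y <= size z -> suffix y z.
Proof.
move=> /[dup] /size_suffix yw; rewrite suffixE => /eqP ey.
move=> /[dup] /size_suffix zw; rewrite suffixE => /eqP ez yz.
rewrite suffixE -[X in drop _ X]ez drop_drop -{2}ey.
by rewrite (_ : size z - size y + (size w - size z) = size w - size y) //; lia.
Qed.

(** Reversing [z] makes its proper suffix [y] a proper prefix, so this occurrence of [y] avoids the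
    last letter [a]. *)
Lemma palindromic_suffix_infix (T : eqType) (u y z : seq T) (a : T) :
  palindrome y -> palindrome z -> suffix z (rcons u a) -> suffix y z ->
  y != z -> infix y u.
Proof.
move=> /eqP py /eqP pz /suffixP[s es] /suffixP[v ez].
have ez' : z = y ++ rev v by rewrite -pz ez rev_cat py.
case/lastP: v ez ez' => [-> | v b _ ez' _]; first by rewrite eqxx.
move: es; rewrite ez' rev_rcons lastI -!rcons_cat => /rcons_inj[-> _].
exact: infix_infix.
Qed.

(* A palindromic suffix [p] absent from [u] is the longest one, and every
   shorter palindromic suffix is also a prefix of [p], so occurs in [u]. *)
Lemma rich_rcons (T : eqType) (u p : seq T) (a : T) :
  rich u -> palindrome p -> suffix p (rcons u a) -> ~~ infix p u ->
  rich (rcons u a).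
Proof.
rewrite /rich => ru pp sp np; rewrite size_rcons -ru -/(size (p :: _)).
apply/perm_size/uniq_perm; first exact/filter_uniq/factors_uniq.
  by rewrite /= mem_filter mem_factors (negPf np) andbF filter_uniq ?factors_uniq.
move=> y; rewrite inE !mem_filter !mem_factors.
have [->|yp] /= := eqVneq y p; first by rewrite pp suffixW.
case: (boolP (palindrome y)) => //= py; rewrite infix_rconsl.
case: (boolP (suffix y _)) => //= sy; apply/esym.
case: (leqP (size y) (size p)) => [yle|/ltnW ple].
  exact: palindromic_suffix_infix py pp sp (suffix_le_size sy sp yle) yp.
case/negP: np; apply: palindromic_suffix_infix pp py sy (suffix_le_size sp sy ple) _.
by rewrite eq_sym.
Qed.

Lemma infinite_rich_criterion (T : eqType) (f : infinite_word T) :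
  (forall i j l, i < j -> palindrome (seg f i l) -> seg f i l = seg f j l ->
     exists2 k, i <= k < j & palindrome (seg f k (j + l - k))) ->
  infinite_rich f.
Proof.
move=> ret y [i ->]; rewrite -/(seg f i _); elim: (size y) => [|n IH] //.
have -> : seg f i n.+1 = rcons (seg f i n) (f (i + n)).
  by rewrite -addn1 seg_cat cats1.
(* The least such [k] starts the longest palindromic suffix; by [ret], an earlier occurrence of that
   suffix would give a smaller start. *)
pose P k := (i <= k) && palindrome (seg f k ((i + n).+1 - k)).
have exP : exists k, P k.
  exists (i + n); rewrite /P leq_addr subSnn.
  exact/eqP.
case: (ex_minnP exP) => k /andP[ik pk] kmin.
have kn : k <= i + n.
  by apply: kmin; rewrite /P leq_addr subSnn; exact/eqP.
apply: rich_rcons (pk) _ _ => //.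
  have -> : rcons (seg f i n) (f (i + n)) = seg f i (k - i + ((i + n).+1 - k)).
    rewrite (_ : k - i + ((i + n).+1 - k) = n + 1); last lia.
    by rewrite seg_cat cats1.
  by rewrite seg_cat subnKC // suffix_suffix.
apply/negP => /seg_factor[j ij []]; rewrite size_seg => jn e.
have jk : j < k by lia.
have pj : palindrome (seg f j ((i + n).+1 - k)) by rewrite -e.
have [m /andP[jm mk]] := ret _ _ _ jk pj (esym e).
rewrite subnKC; last lia.
by move=> pm; have := kmin m; rewrite /P pm (leq_trans ij jm) leqNgt mk => /(_ isT).
Qed.

Lemma take_drop_seg (T : Type) (f : nat -> T) i n k l :
  k + l <= n -> take l (drop k (seg f i n)) = seg f (i + k) l.
Proof.
move=> kln; rewrite (_ : n = k + (l + (n - k - l))); last lia.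
by rewrite !seg_cat drop_size_cat ?size_seg // take_size_cat ?size_seg.
Qed.

(** * The fixed point of the substitution *)

Definition block (x : bool) (r : nat) : bool :=
  match r with 0 | 3 => false | 1 | 2 => x | _ => true end.

(** Fuel makes the recursion on [n %/ 5] structural; any fuel at least [n] gives the same value. *)
Fixpoint toeplitz (fuel n : nat) : bool :=
  if n is 0 then false else
  if fuel is fuel'.+1 then block (toeplitz fuel' (n %/ 5)) (n %% 5) else false.

Definition t (n : nat) : bool := toeplitz n n.

Lemma toeplitz_fuel f g n : n <= f -> n <= g -> toeplitz f n = toeplitz g n.
Proof.
elim: f g n => [|f IH] [|g] [|n] //= nf ng.
by rewrite (IH g) //; lia.
Qed.

Lemma t_divn n : t n = block (t (n %/ 5)) (n %% 5).
Proof.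
case: n => [|n] //; rewrite {1}/t [LHS]/=.
by rewrite (@toeplitz_fuel _ (n.+1 %/ 5)) //; lia.
Qed.

Lemma t_block q r : r < 5 -> t (5 * q + r) = block (t q) r.
Proof. by move=> r5; rewrite t_divn; congr (block (t _) _); lia. Qed.

Lemma seg_t4 q r : r < 5 ->
  seg t (5 * q + r) 4 =
  [seq block (if k < 5 then t q else t q.+1) (k %% 5) | k <- iota r 4].
Proof.
move=> r5; rewrite /seg iotaDl -map_comp; apply/eq_in_map => k.
rewrite mem_iota /= => /andP[_ kr]; rewrite t_divn; congr (block _ _); last lia.
by case: ltnP => k5; congr t; lia.
Qed.

(** * Returns of short palindromes *)

Definition block3 (x : bool) (r : nat) : bool :=
  block (block (block x (r %/ 25)) (r %/ 5 %% 5)) (r %% 5).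

Lemma t_block3 q r : r < 125 -> t (125 * q + r) = block3 (t q) r.
Proof.
move=> r125; rewrite /block3 t_divn; congr block; last lia.
rewrite t_divn; congr block; last lia.
rewrite t_divn; congr block; last lia.
by congr t; lia.
Qed.

(** Length 28 is distance 25 plus palindrome length 3. Images under the cube of the substitution
    have length 125, so a window meets at most two of them. *)
Definition window (s : nat) (x y : bool) : seq bool :=
  [seq block3 (if k < 125 then x else y) (k %% 125) | k <- iota s 28].

Definition windows : seq (seq bool) :=
  undup [seq window s xy.1 xy.2
           | s <- iota 0 125,
             xy <- [seq (x, y) | x <- [:: false; true], y <- [:: false; true]]].

Lemma seg_t_windows i : seg t i 28 \in windows.
Proof.
rewrite mem_undup; apply/allpairsP.
exists (i %% 125, (t (i %/ 125), t (i %/ 125).+1)); split.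
- by rewrite mem_iota /= ltn_mod.
- by case: (t _); case: (t _).
rewrite /= /window {1}(divn_eq i 125) /seg iotaDl -map_comp.
apply/eq_in_map => k; rewrite mem_iota /= => /andP[_ kr].
case: ltnP => k5; rewrite -t_block3 ?ltn_mod //; congr t; lia.
Qed.

Lemma windows_near : all (fun u => all (fun d => all (fun l =>
  palindrome (take l u) && (take l u == take l (drop d u)) ==>
  has (fun k => palindrome (take (d + l - k) (drop k u))) (iota 0 d))
  (iota 0 4)) (iota 1 25)) windows.
Proof. by vm_compute. Qed.

(** Position 25 stands for the later occurrence: 25 preceding letters already give the longer
    palindrome, wherever the earlier occurrence lies. *)
Lemma windows_far : all (fun u => all (fun l =>
  palindrome (take l (drop 25 u)) ==>
  has (fun k => palindrome (take (25 + l - k) (drop k u))) (iota 0 25))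
  (iota 0 4)) windows.
Proof. by vm_compute. Qed.

(** * Synchronization and desubstitution of palindromes *)

Definition block4 (r : nat) (x y : bool) : seq bool :=
  [seq block (if k < 5 then x else y) (k %% 5) | k <- iota r 4].

Lemma block4_inj r s x y x' y' : r < 5 -> s < 5 ->
  block4 r x y = block4 s x' y' -> r = s.
Proof.
by case: r => [|[|[|[|[|r]]]]]; case: s => [|[|[|[|[|s]]]]] // _ _;
  case: x; case: y; case: x'; case: y'.
Qed.

(** The reflection [p -> 3 - p] modulo 5 preserves the pattern [0 x x 0 1] and sends positions
    [s, ..., s + 3] to those starting at [- s]. *)
Lemma block4_rev r s x y x' y' : r < 5 -> s < 5 ->
  block4 r x y = rev (block4 s x' y') -> (r + s) %% 5 = 0.
Proof.
by case: r => [|[|[|[|[|r]]]]]; case: s => [|[|[|[|[|s]]]]] // _ _;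
  case: x; case: y; case: x'; case: y'.
Qed.

Lemma sync i j : seg t i 4 = seg t j 4 -> i = j %[mod 5].
Proof.
rewrite (divn_eq i 5) (divn_eq j 5) ![_ * 5]mulnC !seg_t4 ?ltn_mod // => h.
have := @block4_inj (i %% 5) (j %% 5) _ _ _ _ (ltn_mod _ _) (ltn_mod _ _) h.
lia.
Qed.

Lemma sync_rev i j : seg t i 4 = rev (seg t j 4) -> (i + j) %% 5 = 0.
Proof.
rewrite (divn_eq i 5) (divn_eq j 5) ![_ * 5]mulnC !seg_t4 ?ltn_mod // => h.
have := @block4_rev (i %% 5) (j %% 5) _ _ _ _ (ltn_mod _ _) (ltn_mod _ _) h.
lia.
Qed.

Lemma palindromic_return_short i j l :
  l < 4 -> i < j -> palindrome (seg t i l) -> seg t i l = seg t j l ->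
  exists2 k, i <= k < j & palindrome (seg t k (j + l - k)).
Proof.
move=> l4 ij pi eij; have lm : l \in iota 0 4 by rewrite mem_iota.
have [jd|jd] := leqP j (i + 25).
  have dm : j - i \in iota 1 25 by rewrite mem_iota; lia.
  have := allP (allP (allP windows_near _ (seg_t_windows i)) _ dm) _ lm.
  have -> : take l (seg t i 28) = seg t i l.
    by rewrite -[X in take _ X]drop0 take_drop_seg ?addn0 //; lia.
  rewrite take_drop_seg ?subnKC; try lia.
  rewrite -eij pi eqxx => /hasP[k]; rewrite mem_iota => kd; rewrite take_drop_seg; last lia.
  move=> pk; exists (i + k); first lia.
  by rewrite (_ : j + l - (i + k) = j - i + l - k) //; lia.
have := allP (allP windows_far _ (seg_t_windows (j - 25))) _ lm.
rewrite take_drop_seg ?subnK; try lia.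
rewrite -eij pi => /hasP[k]; rewrite mem_iota => kd; rewrite take_drop_seg; last lia.
move=> pk; exists (j - 25 + k); first lia.
by rewrite (_ : j + l - (j - 25 + k) = 25 + l - k) //; lia.
Qed.

(* An aligned palindrome of [t] is the image of a palindrome up to trimming or
   adding at most two letters on each side.  The return for the desubstituted
   word is lifted back with the same offset [i - 5 a], where [-2 <= i - 5 a <= 2]. *)
Lemma palindromic_return i j l :
  i < j -> palindrome (seg t i l) -> seg t i l = seg t j l ->
  exists2 k, i <= k < j & palindrome (seg t k (j + l - k)).
Proof.
elim/ltn_ind: l i j => l IH i j ij pi eij.
have [l4|l4] := ltnP l 4; first exact: palindromic_return_short.
have sij : i = j %[mod 5].
  apply: sync; have := congr1 (take 4) eij.
  by rewrite -(subnKC l4) !seg_cat !take_size_cat ?size_seg.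
have mij : (i + (i + l - 4)) %% 5 = 0.
  apply: sync_rev.
  have e1 : seg t i l = seg t i 4 ++ seg t (i + 4) (l - 4).
    by rewrite -seg_cat subnKC.
  have e2 : seg t i l = seg t i (l - 4) ++ seg t (i + l - 4) 4.
    by rewrite -{1}(subnK l4) seg_cat addnBA.
  move: pi => /eqP; rewrite {1}e2 {1}e1 rev_cat => /eqP.
  by rewrite eqseq_cat ?size_rev ?size_seg // => /andP[/eqP].
move/seg_palP: (pi) => {}pi; move/eq_segP: eij => eij.
pose a := (i + 2) %/ 5; pose b := (j + 2) %/ 5; pose m := (i + l + 3) %/ 5 - a.
have ba : j + 5 * a = i + 5 * b by rewrite /a /b; lia.
have il : (i + i + l).+1 = 5 * (a + a + m) by rewrite /m /a; lia.
have ia : (i <= 5 * a + 2) && (5 * a <= i + 2) by rewrite /a; lia.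
have pi' : palindrome (seg t a m).
  apply/seg_palP => x y ax ay xy.
  (* The end blocks may be trimmed by two letters, so the two inner copies of the desubstituted
     letters are compared. *)
  have [xy'|yx|-> //] := ltngtP x y.
    by have := pi (5 * x + 2) (5 * y + 1); rewrite !t_block //=; apply; lia.
  by have := pi (5 * x + 1) (5 * y + 2); rewrite !t_block //=; apply; lia.
have eij' : seg t a m = seg t b m.
  apply/eq_segP => k km.
  have [k1|k2] := leqP i (5 * (a + k) + 1).
    have := eij (5 * (a + k) + 1 - i); rewrite subnKC //.
    rewrite (_ : j + _ = 5 * (b + k) + 1); last lia.
    by rewrite !t_block //=; apply; lia.
  have := eij (5 * (a + k) + 2 - i); rewrite subnKC; last lia.
  rewrite (_ : j + _ = 5 * (b + k) + 2); last lia.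
  by rewrite !t_block //=; apply; lia.
have ml : m < l by rewrite /m /a; lia.
have ab : a < b by lia.
have [k ak /seg_palP pk] := IH m ml a b ab pi' eij'.
exists (5 * k + i - 5 * a); first lia.
apply/seg_palP => x y kx ky xy.
have xy5 : (x + y).+2 = 5 * (k + (b + m)) by lia.
rewrite (divn_eq x 5) (divn_eq y 5) ![_ * 5]mulnC !t_block ?ltn_mod //.
(* Mirror residues sum to 3 modulo 5: 0 pairs with 3, 1 with 2, and 4 with itself; only the pair 1,
   2 uses [pk]. *)
have : y %% 5 = (8 - x %% 5) %% 5 by lia.
have : x %% 5 < 5 by rewrite ltn_mod.
case E: (x %% 5) => [|[|[|[|[|r]]]]] // _ -> //=; apply: pk; lia.
Qed.

(** * Prefix sums and additive 5-powers *)

Definition psum (n : nat) : nat := \sum_(j < n) t j.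

Lemma psumS n : psum n.+1 = psum n + t n.
Proof. exact: big_ord_recr. Qed.

Definition block_sum (x : bool) (r : nat) : nat :=
  match r with 0 | 1 => 0 | 2 => x | _ => 2 * x end.

Lemma psum_block q r : r < 5 -> psum (5 * q + r) = q + 2 * psum q + block_sum (t q) r.
Proof.
have step k : psum (5 * k) = k + 2 * psum k -> forall s, s < 5 ->
    psum (5 * k + s) = k + 2 * psum k + block_sum (t k) s.
  move=> hk; elim=> [|s IHs] s5; first by rewrite addn0 hk addn0.
  rewrite addnS psumS IHs ?t_block; try lia.
  by case: s s5 {IHs} => [|[|[|[|]]]] //=; case: (t k); lia.
apply: (step); elim: q => [|q IH]; first by rewrite muln0 /psum big_ord0.
rewrite mulnS addnC addnS psumS (step q) // t_block // psumS /=; lia.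
Qed.

(** The parity of [psum n - n] for [n = 5 q + r] and [x = t q], since [5 q] and [q] have equal
    parity. *)
Definition parity (x : bool) (r : nat) : bool := odd r (+) (r == 2) && x.

Lemma odd_psum n : odd (psum n) = odd n (+) parity (t (n %/ 5)) (n %% 5).
Proof.
rewrite {1 2}(divn_eq n 5) mulnC psum_block ?ltn_mod // /parity.
have : n %% 5 < 5 by rewrite ltn_mod.
by case: (n %% 5) => [|[|[|[|[|r]]]]] // _; case: (t _) => /=; lia.
Qed.

(** Five equal increments between six boundaries amount to four vanishing second differences. *)
Definition second_diff0 (f : nat -> nat) : Prop :=
  forall j, j < 4 -> f j + f j.+2 = 2 * f j.+1.

Lemma parity_period2 r m (x : nat -> bool) : r < 5 -> m < 5 ->
  (forall j, j < 4 ->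
     parity (x j) ((r + j * m) %% 5) = parity (x j.+2) ((r + j.+2 * m) %% 5)) ->
  m = 0.
Proof.
move=> r5 m5 h; move: (h 0 isT) (h 1 isT) (h 2 isT) (h 3 isT) => {h}.
move: (x 0) (x 1) (x 2) (x 3) (x 4) (x 5) => a b c d e f.
by case: m m5 => [|[|[|[|[|m]]]]] // _; case: r r5 => [|[|[|[|[|r]]]]] // _;
  case: a; case: b; case: c; case: d; case: e; case: f.
Qed.

Lemma parity_antiperiod2 r m (x : nat -> bool) : r < 5 -> m < 5 ->
  (forall j, j < 5 -> block (x j) ((r + j * m) %% 5) =
                   ~~ block (x j.+1) ((r + j.+1 * m) %% 5)) ->
  ~ (forall j, j < 4 -> parity (x j) ((r + j * m) %% 5) =
                     ~~ parity (x j.+2) ((r + j.+2 * m) %% 5)).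
Proof.
move=> r5 m5 k h; move: (h 0 isT) (h 1 isT) (h 2 isT) (h 3 isT) => {h}.
move: (k 0 isT) (k 1 isT) (k 2 isT) (k 3 isT) (k 4 isT) => {k}.
move: (x 0) (x 1) (x 2) (x 3) (x 4) (x 5) => a b c d e f.
by case: m m5 => [|[|[|[|[|m]]]]] // _; case: r r5 => [|[|[|[|[|r]]]]] // _;
  case: a; case: b; case: c; case: d; case: e; case: f.
Qed.

Lemma modn_progression i n j :
  (i + j * n) %% 5 = (i %% 5 + j * (n %% 5)) %% 5.
Proof. by rewrite -modnDm -modnMmr modnDm modnDml. Qed.

(** When the letters alternate, halving the second-difference equation makes [psum] at [j] and
    [j + 2] differ in parity. *)
Lemma no_alternating_progression i n :
  (forall j, j < 5 -> t (i + j * n) = ~~ t (i + j.+1 * n)) ->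
  ~ second_diff0 (fun j => 2 * psum (i + j * n) + t (i + j * n)).
Proof.
move=> alt sd; pose x j := t ((i + j * n) %/ 5).
apply: (@parity_antiperiod2 (i %% 5) (n %% 5) x); rewrite ?ltn_mod //.
  by move=> j /alt; rewrite /x -!modn_progression [LHS]t_divn [t (i + j.+1 * n)]t_divn.
move=> j j4; have := sd j j4; have a0 := alt j (ltnW j4); have a1 := alt j.+1 j4.
have := odd_psum (i + j * n); have := odd_psum (i + j.+2 * n).
rewrite -!modn_progression -/(x j) -/(x j.+2) a0 a1.
case: (t _) => /=; case: (parity _ _); case: (parity _ _) => /=; lia.
Qed.

Lemma no_5_progression n i : 0 < n -> ~ second_diff0 (fun j => psum (i + j * n)).
Proof.
elim/ltn_ind: n i => n IH i n0 sd; pose x j := t ((i + j * n) %/ 5).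
have m0 : n %% 5 = 0.
  apply: (@parity_period2 (i %% 5) _ x); rewrite ?ltn_mod // => j j4.
  have := sd j j4; have := odd_psum (i + j * n); have := odd_psum (i + j.+2 * n).
  rewrite -!modn_progression -/(x j) -/(x j.+2).
  case: (parity _ _); case: (parity _ _) => //=; lia.
pose q := i %/ 5; pose m := n %/ 5.
have nm : n = 5 * m by rewrite /m; lia.
have mn : m < n by lia.
have m_gt0 : 0 < m by lia.
have {x}ps j : psum (i + j * n) =
    q + j * m + 2 * psum (q + j * m) + block_sum (t (q + j * m)) (i %% 5).
  rewrite -psum_block ?ltn_mod //; congr psum; rewrite nm /q; lia.
(* The linear term [q + j * m] has zero second difference and cancels. *)
have {}sd : second_diff0 (fun j => 2 * psum (q + j * m) + block_sum (t (q + j * m)) (i %% 5)).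
  by move=> j j4; have := sd j j4; rewrite !ps; lia.
move: sd; have : i %% 5 < 5 by rewrite ltn_mod.
have same c : second_diff0 (fun j => 2 * psum (q + j * m) + c) -> False.
  by move=> sd; apply: (IH m mn q m_gt0) => j j4; have := sd j j4; lia.
(* Adding the letter shifts every boundary by one: [psum q + t q = psum q.+1]. *)
have next : second_diff0 (fun j => 2 * psum (q + j * m) + 2 * t (q + j * m)) -> False.
  move=> sd; apply: (IH m mn q.+1 m_gt0) => j j4; have := sd j j4.
  by rewrite !addSn !psumS; lia.
(* Residues 0 and 1 add nothing, 3 and 4 fall under [next]; residue 2 adds a single letter and
   remains. *)
case: (i %% 5) => [|[|[|[|[|r]]]]] //= _; [exact: same | exact: same | ].
move=> sd.
have period j : j < 4 -> t (q + j * m) = t (q + j.+2 * m).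
  by move=> j4; have := sd j j4; case: (t _); case: (t (q + j.+2 * m)) => //=; lia.
have [e|e] := eqVneq (t (q + 0 * m)) (t (q + 1 * m)).
  apply: (same (t (q + 0 * m))) => j j4; have := sd j j4.
  have c k : k < 6 -> t (q + k * m) = t (q + 0 * m).
    by case: k => [|[|[|[|[|[|k]]]]]] // _; rewrite -?period.
  by rewrite !c //; lia.
apply: no_alternating_progression sd => j j5.
by move: e; case: j j5 => [|[|[|[|[|j]]]]] // _; rewrite -?period //;
  case: (t (q + 0 * m)); case: (t (q + 1 * m)).
Qed.

(** * Transfer to integer words *)

Lemma nth_flatten_seg (T : eqType) (f : nat -> T) n (ws : seq (seq T)) i :
  {in ws, forall u, size u = n} ->
  flatten ws = seg f i (size (flatten ws)) ->
  forall j, j < size ws -> nth [::] ws j = seg f (i + j * n) n.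
Proof.
elim: ws i => [|u ws IH] i //= hn.
have un : size u = n by apply: hn; rewrite mem_head.
rewrite size_cat seg_cat => /eqP.
rewrite eqseq_cat ?size_seg // => /andP[/eqP eu /eqP ews] [|j] /= jlt.
  by rewrite addn0 {1}eu un.
rewrite mulSn addnA; apply: IH => //; last by rewrite -{1}un.
by move=> v vws; apply: hn; rewrite inE vws orbT.
Qed.

Definition letter (x : bool) : int := if x then 1%R else 0%R.

Lemma letter_inj : injective letter.
Proof. by case; case. Qed.

Lemma palindrome_map (T U : eqType) (f : T -> U) (u : seq T) :
  injective f -> palindrome (map f u) = palindrome u.
Proof. by move=> fI; rewrite /palindrome -map_rev (inj_eq (inj_map fI)). Qed.

Lemma psum_seg i n :
  (Posz (psum (i + n)) = Posz (psum i) + word_sum (seg (letter \o t) i n))%R.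
Proof.
elim: n => [|n IH]; first by rewrite addn0 /word_sum big_nil; lia.
rewrite addnS psumS -[n.+1]addn1 seg_cat /word_sum big_cat /= big_seq1.
rewrite PoszD IH /word_sum -GRing.addrA; congr (_ + (_ + _))%R; by rewrite /=; case: (t _).
Qed.

Theorem theorem1p1 :
  exists w : infinite_word int,
    [/\ word_over ([:: 0%R; 1%R] : seq int) w, infinite_rich w & additive_power_free 5 w].
Proof.
exists (letter \o t); split.
- by move=> i /=; case: (t i).
- apply: infinite_rich_criterion => i j l ij.
  rewrite !seg_comp palindrome_map; last exact: letter_inj.
  move=> pi /(inj_map letter_inj) eij.
  have [k kij pk] := palindromic_return ij pi eij.
  by exists k => //; rewrite seg_comp palindrome_map //; exact: letter_inj.
move=> y [i ey] [ws [ws5 yws ne eqs]].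
have nthws j : j < 5 -> nth [::] ws j \in ws by move=> j5; rewrite mem_nth ?ws5.
have ws0 := nthws 0 isT.
pose n := size (nth [::] ws 0).
have hn : {in ws, forall u, size u = n} by move=> u uw; case: (eqs u _ uw ws0).
apply: (@no_5_progression n i).
  by rewrite lt0n size_eq0; apply/eqP; apply: ne.
rewrite yws in ey; have hw := nth_flatten_seg hn ey; rewrite ws5 in hw.
(* Equal sums of blocks [j] and [j + 1] are exactly the [j]-th second-difference equation. *)
move=> j j4.
have [_] := eqs _ _ (nthws j (ltnW j4)) (nthws j.+1 j4).
rewrite !hw //; last exact: ltnW.
have := psum_seg (i + j * n) n; have := psum_seg (i + j.+1 * n) n.
have -> : i + j * n + n = i + j.+1 * n by rewrite mulSn; lia.
have -> : i + j.+1 * n + n = i + j.+2 * n by rewrite !mulSn; lia.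
by move=> h1 h0 e; move: h0; rewrite e /=; move: (word_sum _) h1 => s; lia.
Qed.
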